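(* Let $\Sigma$ be a finite signature containing two distinct atoms $p_1,p_2$. Then there is no formula $\gamma$ built from atoms of $\Sigma$ using only the connectives $\bot,\vee,\to$ such that $[\![\gamma]\!]=[\![p_1\wedge p_2]\!]$.
   Context: $\Sigma$ is a finite set of atoms. Formulas are given by $\alpha ::= \bot \mid p \mid \alpha_1\wedge\alpha_2 \mid \alpha_1\vee\alpha_2 \mid \alpha_1\rightarrow\alpha_2$ with $p\in\Sigma$. A partial interpretation is a map $v:\Sigma\to\{0,1,2\}$; $\mathcal I$ is the set of all of them and $\mathcal I_c$ the set of classical ones (no atom mapped to $1$). The order on $\mathcal I$: $u\le v$ iff for every atom $p$, $u(p)\le v(p)$ and ($u(p)=0$ implies $v(p)=0$). For $S\subseteq\mathcal I$: $\overline S=\mathcal I\setminus S$; $S_c=S\cap\mathcal I_c$; $S\downarrow=\{u\in\mathcal I:\exists v\in S,\ v\ge u\}$ (so $S_c\downarrow=(S_c)\downarrow$). The denotation: $[\![\bot]\!]=\emptyset$; $[\![p]\!]=\{v\in\mathcal I: v(p)=2\}$; $[\![\alpha\wedge\beta]\!]=[\![\alpha]\!]\cap[\![\beta]\!]$; $[\![\alpha\vee\beta]\!]=[\![\alpha]\!]\cup[\![\beta]\!]$; $[\![\alpha\to\beta]\!]=\big(\overline{[\![\alpha]\!]}\cup[\![\beta]\!]\big)\cap\big(\overline{[\![\alpha]\!]}\cup[\![\beta]\!]\big)_c\downarrow$. *)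

(* Defs.v *)
From mathcomp Require Import all_boot.

Set Implicit Arguments.
Unset Strict Implicit.
Unset Printing Implicit Defensive.

Inductive formula (Sigma : Type) : Type :=
| Bot
| Atom (p : Sigma)
| And (a b : formula Sigma)
| Or (a b : formula Sigma)
| Imp (a b : formula Sigma).

Arguments Bot {Sigma}.

Fixpoint and_free (Sigma : Type) (a : formula Sigma) : bool :=
  match a with
  | Bot | Atom _ => true
  | And _ _ => false
  | Or b c | Imp b c => and_free b && and_free c
  end.

Section Denotation.
Variable Sigma : finType.

Definition interp := {ffun Sigma -> 'I_3}.

Definition classical : {set interp} :=
  [set v : interp | [forall p, (v p : nat) != 1]].

Definition interp_le (u v : interp) : bool :=
  [forall p, (u p <= v p) && ((u p == 0 :> nat) ==> (v p == 0 :> nat))].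

Definition class_part (S : {set interp}) : {set interp} := S :&: classical.

Definition down (S : {set interp}) : {set interp} :=
  [set u : interp | [exists v in S, interp_le u v]].

Fixpoint den (a : formula Sigma) : {set interp} :=
  match a with
  | Bot => set0
  | Atom p => [set v : interp | (v p : nat) == 2]
  | And b c => den b :&: den c
  | Or b c => den b :|: den c
  | Imp b c => (~: den b :|: den c) :&: down (class_part (~: den b :|: den c))
  end.

End Denotation.

(* Main.v *)
Require Import Defs.
From mathcomp Require Import all_boot.

(** Every interpretation lies below exactly one classical interpretation, so
    [Imp a b] holds at [u] iff the material implication holds both at [u] and
    at the classical interpretation above [u].  Let [top] map every atom to 2,
    and let [dent p] differ from it only in mapping [p] to 1.  An and-free
    formula true at [top] is also true at [dent p1] or at [dent p2]: an atom
    differs from [p1] or from [p2], [Or] inherits the property from a true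
    disjunct, and [Imp a b] inherits it from [b], unless [a] fails at [top],
    in which case it fails at both dents by persistence.  The conjunction of
    [p1] and [p2] is true at [top] and at neither dent. *)

Section Persistence.
Variable Sigma : finType.
Implicit Types (u v w : interp Sigma) (a b : formula Sigma).

Lemma interp_le_refl u : interp_le u u.
Proof. by apply/forallP => q; rewrite leqnn implybb. Qed.

Lemma interp_leP u v q :
  interp_le u v -> (u q <= v q) && ((u q == 0 :> nat) ==> (v q == 0 :> nat)).
Proof. by move/forallP. Qed.

(** The order fixes the values 0 and 2, and a classical interpretation above must raise every 1 to
    2. *)
Lemma classical_above_unique u v w :
  v \in classical Sigma -> w \in classical Sigma ->
  interp_le u v -> interp_le u w -> v = w.
Proof.
rewrite !inE => /forallP vc /forallP wc uv uw.
apply/ffunP => q; apply: val_inj => /=.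
move: (vc q) (wc q) (interp_leP _ _ q uv) (interp_leP _ _ q uw).
case: (u q) (v q) (w q) => [[|[|[|?]]] ?] [[|[|[|?]]] ?] [[|[|[|?]]] ?] //=.
Qed.

Lemma in_den_Imp a b u v : v \in classical Sigma -> interp_le u v ->
  (u \in den (Imp a b)) =
    ((u \in den a) ==> (u \in den b)) && ((v \in den a) ==> (v \in den b)).
Proof.
move=> vc uv; rewrite /= in_setI in_setU in_setC -implybE; congr andb.
rewrite inE; apply/existsP/idP => [[w]|vab].
  rewrite in_setI in_setU in_setC -implybE => /andP[/andP[wab wc] uw].
  by rewrite (classical_above_unique _ _ _ vc wc uv uw).
by exists v; rewrite in_setI in_setU in_setC -implybE vab vc.
Qed.

(** The value 2 is maximal, which settles atoms; an implication true at [u] already includes the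
    material implication at [v]. *)
Lemma den_persistent a u v : v \in classical Sigma -> interp_le u v ->
  u \in den a -> v \in den a.
Proof.
move=> vc uv; elim: a => [|p|a IHa b IHb|a IHa b IHb|a _ b _].
- by rewrite inE.
- rewrite !inE => /eqP up; have /andP[] := interp_leP _ _ p uv.
  by rewrite up => vp _; rewrite eqn_leq vp -ltnS ltn_ord.
- by rewrite !in_setI => /andP[/IHa-> /IHb->].
- by rewrite !in_setU => /orP[/IHa->|/IHb->]; rewrite ?orbT.
- rewrite (in_den_Imp _ _ _ _ vc uv) (in_den_Imp _ _ _ _ vc (interp_le_refl v)).
  by case/andP=> _ ->.
Qed.

End Persistence.

Section Dents.
Variable Sigma : finType.

Definition top : interp Sigma := [ffun _ => inord 2].

Definition dent (p : Sigma) : interp Sigma :=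
  [ffun q => if q == p then inord 1 else inord 2].

Lemma top_classical : top \in classical Sigma.
Proof. by rewrite inE; apply/forallP => q; rewrite ffunE inordK. Qed.

Lemma dent_le_top p : interp_le (dent p) top.
Proof. by apply/forallP => q; rewrite !ffunE; case: ifP; rewrite !inordK. Qed.

Lemma top_in_Atom q : top \in den (Atom q).
Proof. by rewrite inE ffunE inordK. Qed.

Lemma dent_in_Atom p q : (dent p \in den (Atom q)) = (q != p).
Proof. by rewrite inE ffunE; case: ifP; rewrite inordK. Qed.

Lemma and_free_dent (p1 p2 : Sigma) (a : formula Sigma) :
  p1 != p2 -> and_free a -> top \in den a ->
  (dent p1 \in den a) || (dent p2 \in den a).
Proof.
move=> p12; elim: a => [|q|//|a IHa b IHb|a _ b IHb].
- by rewrite inE.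
- by rewrite !dent_in_Atom; case: eqP => // ->.
- case/andP=> /IHa{}IHa /IHb{}IHb; rewrite !in_setU.
  by case/orP=> [/IHa|/IHb] /orP[] ->; rewrite ?orbT.
- case/andP=> _ /IHb{}IHb.
  (* [top] is the classical interpretation above itself and above both dents, so [ab] settles the
     classical half at each dent. *)
  rewrite (in_den_Imp _ _ _ _ _ top_classical (interp_le_refl _ _)) andbb => ab.
  rewrite !(in_den_Imp _ _ _ _ _ top_classical (dent_le_top _)) ab !andbT.
  have [ta|tNa] := boolP (top \in den a).
    by move: ab; rewrite ta => /IHb /orP[] ->; rewrite !implybT ?orbT.
  suff /negPf-> : dent p1 \notin den a by [].
  exact: contra (den_persistent _ _ _ _ top_classical (dent_le_top _)) tNa.
Qed.

End Dents.

Theorem theorem5 (Sigma : finType) (p1 p2 : Sigma) (hp : p1 != p2) :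
  ~ (exists gamma : formula Sigma,
       and_free gamma /\ den gamma = den (And (Atom p1) (Atom p2))).
Proof.
case=> g [gfree gE]; have := and_free_dent _ _ _ _ hp gfree.
rewrite gE !in_setI -!/(den (Atom _)) !top_in_Atom !dent_in_Atom !eqxx.
by rewrite andbF => /(_ isT).
Qed.
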